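(* For all $n\ge3$, we have $c_n(123,231,312)=n$.
   Context: A word $\pi=\pi_1\dots\pi_m$ over the positive integers contains the pattern $\sigma=\sigma_1\dots\sigma_k$ if there are indices $1\le i_1<\dots<i_k\le m$ such that for all $r,s\in\{1,\dots,k\}$: $\pi_{i_r}<\pi_{i_s}$ iff $\sigma_r<\sigma_s$, and $\pi_{i_r}=\pi_{i_s}$ iff $\sigma_r=\sigma_s$; otherwise $\pi$ avoids $\sigma$. $\mathcal{C}_n$ denotes the set of nonnesting permutations: arrangements (words) of the multiset $\{1,1,2,2,\dots,n,n\}$ that avoid the patterns $1221$ and $2112$. For patterns $\sigma,\tau,\dots$, $c_n(\sigma,\tau,\dots)$ is the number of $\pi\in\mathcal{C}_n$ avoiding all of $\sigma,\tau,\dots$. *)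

(* Defs.v *)
From mathcomp Require Import all_boot.

Set Implicit Arguments.
Unset Strict Implicit.
Unset Printing Implicit Defensive.

Definition contains (pi sigma : seq nat) : bool :=
  [exists f : {ffun 'I_(size sigma) -> 'I_(size pi)},
    [forall r : 'I_(size sigma), forall s : 'I_(size sigma),
       (r < s) ==> (f r < f s)] &&
    [forall r : 'I_(size sigma), forall s : 'I_(size sigma),
      ((nth 0 pi (f r) < nth 0 pi (f s)) == (nth 0 sigma r < nth 0 sigma s)) &&
      ((nth 0 pi (f r) == nth 0 pi (f s)) ==
         (nth 0 sigma r == nth 0 sigma s))]].

Definition avoids (pi sigma : seq nat) : bool := ~~ contains pi sigma.

Definition double_word (n : nat) : seq nat :=
  flatten [seq [:: i; i] | i <- iota 1 n].

(* [permutations] is duplicate-free, also on words with repeated letters, so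
   the size of this list is the number of nonnesting permutations. *)
Definition nonnesting (n : nat) : seq (seq nat) :=
  [seq pi <- permutations (double_word n)
     | avoids pi [:: 1; 2; 2; 1] && avoids pi [:: 2; 1; 1; 2]].

Definition c (n : nat) (patterns : seq (seq nat)) : nat :=
  size [seq pi <- nonnesting n | all (avoids pi) patterns].

(* Main.v *)
Require Import Defs.
From mathcomp Require Import all_boot.
From mathcomp Require Import zify.

Set Implicit Arguments.
Unset Strict Implicit.
Unset Printing Implicit Defensive.

(** The patterns 123, 231, 312 are the three even patterns on three letters, so
    avoiding them means that any three distinct letters, read along the word,
    are cyclically descending: each such triple is a rotation of a descending
    one.

    Once the first letter [k] is known, this forces the rest of the word.  Two
    distinct letters [x], [y] other than [k], read in this order, must make
    [k], [x], [y] cyclically descending, which says that [x] comes before [y]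
    in the list [k, k-1, ..., 1, n, n-1, ..., k+1], encoded by the total order
    [desc_from k].  Only the second copy of [k] escapes this argument, and this
    is where nonnesting and [3 <= n] enter: it must follow the first copy
    immediately ([adjacent_heads]).  Hence the word is sorted for
    [desc_from k] ([sorted_desc_from_head]), and so it is
    [k k ... 1 1 n n ... k+1 k+1].

    Conversely, a word sorted for [desc_from k] avoids all five patterns,
    because a subsequence of a sorted word is sorted and no word isomorphic to
    one of these patterns is sorted ([sorted_avoids]).  So the words counted
    are the [n] sorted rearrangements of the multiset, one for each possible
    first letter. *)

(** * Pattern containment through subsequences *)

(** Boolean, and quantified over lists of positions, so that it reduces to a
    conjunction of comparisons when both words are explicit. *)
Definition order_iso (s t : seq nat) : bool :=
  (size s == size t) &&
  all (fun i => all (fun j =>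
      ((nth 0 s i < nth 0 s j) == (nth 0 t i < nth 0 t j)) &&
      ((nth 0 s i == nth 0 s j) == (nth 0 t i == nth 0 t j)))
    (iota 0 (size t))) (iota 0 (size t)).

Lemma subseq_of_indices (s : seq nat) (l : seq nat) :
  sorted ltn l -> all (gtn (size s)) l -> subseq [seq nth 0 s i | i <- l] s.
Proof.
move=> sl /allP bl; rewrite -[X in subseq _ X](mkseq_nth 0) /mkseq.
apply: map_subseq.
suff -> : l = [seq i <- iota 0 (size s) | i \in l] by apply: filter_subseq.
apply: (irr_sorted_eq ltn_trans ltnn) => //.
  by apply: (sorted_filter ltn_trans); apply: iota_ltn_sorted.
move=> i; rewrite mem_filter mem_iota add0n /=.
by case il: (i \in l) => //=; have /= -> := bl i il.
Qed.

Lemma indices_of_subseq (s t : seq nat) :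
  subseq t s ->
  exists l, [/\ sorted ltn l, all (gtn (size s)) l &
               t = [seq nth 0 s i | i <- l]].
Proof.
case/subseqP => m _ ->; exists (mask m (iota 0 (size s))); split.
- by apply: (sorted_mask ltn_trans); apply: iota_ltn_sorted.
- by apply/allP => i /mem_mask; rewrite mem_iota.
- by rewrite map_mask -[in LHS](mkseq_nth 0 s).
Qed.

Lemma containsP (w p : seq nat) :
  reflect (exists2 s, subseq s w & order_iso s p) (contains w p).
Proof.
apply: (iffP existsP) => [[f /andP[/forallP mf /forallP isof]]|[s sw iso]].
  pose l := [seq val (f i) | i <- enum 'I_(size p)].
  have szl : size l = size p by rewrite size_map size_enum_ord.
  have nl (i : 'I_(size p)) : nth 0 l i = f i.
    by rewrite (nth_map i) ?size_enum_ord // nth_ord_enum.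
  exists [seq nth 0 w i | i <- l].
    apply: subseq_of_indices.
      apply/(sortedP 0) => i; rewrite szl => ip.
      have /forallP/(_ (Ordinal ip))/implyP := mf (Ordinal (ltnW ip)).
      by rewrite -!nl; apply.
    by apply/allP => _ /mapP[i _ ->]; apply: ltn_ord.
  rewrite /order_iso size_map szl eqxx /=.
  apply/allP => i; rewrite mem_iota /= => ip.
  apply/allP => j; rewrite mem_iota /= => jp.
  have /forallP/(_ (Ordinal jp)) := isof (Ordinal ip).
  by rewrite -!nl !(nth_map 0) ?szl.
case/andP: iso => /eqP szs /allP iso.
have [l [sl bl def_s]] := indices_of_subseq sw.
have szl : size l = size p by rewrite -szs def_s size_map.
have lb (i : 'I_(size p)) : nth 0 l i < size w.
  by apply: (allP bl); rewrite mem_nth // szl.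
exists [ffun i => Ordinal (lb i)]; apply/andP; split.
  apply/forallP => i; apply/forallP => j; apply/implyP => ij.
  rewrite !ffunE /=; apply: (sorted_ltn_nth ltn_trans) => //;
  by rewrite inE szl.
apply/forallP => i; apply/forallP => j; rewrite !ffunE /=.
have memI (q : 'I_(size p)) : val q \in iota 0 (size p) by rewrite mem_iota /=.
have /allP/(_ _ (memI j)) := iso _ (memI i).
by rewrite def_s !(nth_map 0) ?szl; try exact: ltn_ord.
Qed.

(** * The descending order from a given letter *)

(** The order in which letters are met when counting down cyclically from [k]:
    [k, k-1, ..., 1, n, n-1, ..., k+1], for any upper bound [n]. *)
Definition desc_from (k x y : nat) : bool :=
  [|| y <= x <= k, x <= k < y | k < y <= x].

Lemma desc_from_total k : total (desc_from k).
Proof. by move=> x y; rewrite /desc_from; lia. Qed.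

Lemma desc_from_trans k : transitive (desc_from k).
Proof. by move=> y x z; rewrite /desc_from; lia. Qed.

Lemma desc_from_anti k : antisymmetric (desc_from k).
Proof. by move=> x y; rewrite /desc_from; lia. Qed.

Lemma desc_from_min k x : desc_from k k x.
Proof. by rewrite /desc_from; lia. Qed.

(** A subsequence of a sorted word is sorted.  For 1221 and 2112 this would
    contradict antisymmetry; for the even patterns, it would make three
    cyclically ascending letters cyclically descending. *)
Lemma sorted_avoids k w p :
  sorted (desc_from k) w ->
  p \in [:: [:: 1; 2; 2; 1]; [:: 2; 1; 1; 2];
            [:: 1; 2; 3]; [:: 2; 3; 1]; [:: 3; 1; 2]] ->
  avoids w p.
Proof.
move=> sw pin; apply/negP => /containsP[s /(subseq_sorted (@desc_from_trans k))].
move=> /(_ sw); rewrite /order_iso; move: pin; rewrite !inE.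
case/or4P => [/eqP->|/eqP->|/eqP->|/orP[]/eqP->];
  case: s => [|a [|b [|d [|e [|? ?]]]]] //=; rewrite /desc_from; lia.
Qed.

(** * Words avoiding the three even patterns *)

(** The even patterns collected in one condition, which rotation preserves: the
    alternatives are 123, 312 and 231. *)
Definition cyc_asc (a b d : nat) : bool :=
  [|| a < b < d, b < d < a | d < a < b].

Definition even_patterns : seq (seq nat) :=
  [:: [:: 1; 2; 3]; [:: 2; 3; 1]; [:: 3; 1; 2]].

Lemma avoids_cyc_asc w a b d :
  all (avoids w) even_patterns -> subseq [:: a; b; d] w -> ~~ cyc_asc a b d.
Proof.
rewrite /= andbT => /and3P[a1 a2 a3] sw; apply/negP.
by case/or3P => H; [case/negP: a1|case/negP: a3|case/negP: a2];
  apply/containsP; exists [:: a; b; d]; rewrite // /order_iso /=; lia.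
Qed.

(** Exchanging two letters reverses the cyclic order, so three distinct letters
    cannot be read both ways. *)
Lemma avoids_swap w a b d :
  all (avoids w) even_patterns -> uniq [:: a; b; d] ->
  subseq [:: a; b; d] w -> ~~ subseq [:: b; a; d] w.
Proof.
move=> av un s1; apply/negP => s2; move: un.
have := avoids_cyc_asc av s1; have := avoids_cyc_asc av s2.
by rewrite /cyc_asc /= !inE; lia.
Qed.

Lemma avoids_nesting w a b :
  avoids w [:: 1; 2; 2; 1] -> avoids w [:: 2; 1; 1; 2] -> a != b ->
  ~~ subseq [:: a; b; b; a] w.
Proof.
move=> av1 av2 ab; apply/negP => sw.
have [lt_ab|le_ba] := ltnP a b; [case/negP: av1|case/negP: av2];
  by apply/containsP; exists [:: a; b; b; a]; rewrite // /order_iso /=; lia.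
Qed.

(** If [x] stands between two copies of [k], a third letter [y] behind the
    second copy can be read as both [k x y] and [x k y].  So [y] also stands
    between the copies, and then by symmetry [x] cannot occur behind them:
    both copies of [x] are nested in those of [k]. *)
Lemma adjacent_heads k x y p q :
  let w := k :: p ++ k :: q in
  all (avoids w) even_patterns ->
  avoids w [:: 1; 2; 2; 1] -> avoids w [:: 2; 1; 1; 2] ->
  uniq [:: k; x; y] -> count_mem x w = 2 -> y \in w -> x \notin p.
Proof.
move=> w av av1 av2 un cx yw; apply/negP => xp.
move: un; rewrite /= !inE negb_or !andbT => /andP[/andP[kx ky] xy].
have behind u v : u \in p -> k != u -> k != v -> u != v -> v \notin q.
  move=> up ku kv uv; apply/negP => vq.
  have un : uniq [:: k; u; v] by rewrite /= !inE negb_or ku kv uv.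
  have s1 : subseq [:: k; u; v] w.
    rewrite /w /= eqxx -cat1s; apply: cat_subseq; rewrite sub1seq //.
    by rewrite inE vq orbT.
  have s2 : subseq [:: u; k; v] w.
    apply: (subseq_trans _ (subseq_cons _ k)).
    rewrite -[[:: u; k; v]]/([:: u] ++ [:: k; v]).
    by apply: cat_subseq; rewrite /= ?eqxx ?sub1seq.
  by case/negP: (avoids_swap av un s1).
have yq := behind x y xp kx ky xy.
have yp : y \in p.
  move: yw; rewrite /w in_cons mem_cat in_cons ![y == k]eq_sym.
  by rewrite (negPf ky) (negPf yq) !orbF.
have xq : x \notin q by apply: (behind y) => //; rewrite eq_sym.
have cxp : count_mem x p = 2.
  move: cx; rewrite /w /= count_cat /= (negPf kx).
  by rewrite (count_memPn xq) !add0n addn0.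
have := avoids_nesting av1 av2 kx; rewrite /w /= eqxx.
have -> : [:: x; x; k] = nseq 2 x ++ [:: k] by [].
case/negP; apply: cat_subseq; last by rewrite sub1seq inE eqxx.
rewrite -cxp -size_filter.
have /all_pred1P <- : all (pred1 x) (filter (pred1 x) p) by apply: filter_all.
exact: filter_subseq.
Qed.

(** * The words that are counted *)

Lemma count_double_word n x :
  count_mem x (double_word n) = (0 < x <= n) * 2.
Proof.
have -> : (0 < x <= n) = (x \in iota 1 n) by rewrite mem_iota add1n ltnS.
rewrite -(count_uniq_mem _ (iota_uniq _ _)) /double_word.
by elim: (iota 1 n) => //= i s ->; lia.
Qed.

Lemma mem_double_word n x : (x \in double_word n) = (0 < x <= n).
Proof. by rewrite -has_pred1 has_count count_double_word; case: (_ && _). Qed.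

(** For distinct letters [x], [y] other than [k], descending cyclically from [k]
    through [x] to [y] is what [desc_from k x y] means, and the head [k] stands
    before all of them.  Pairs that begin with [k] are harmless since [k] is
    minimal, and by [adjacent_heads] no other letter precedes a [k]. *)
Lemma sorted_desc_from_head n k w :
  3 <= n -> perm_eq (k :: w) (double_word n) ->
  all (avoids (k :: w)) even_patterns ->
  avoids (k :: w) [:: 1; 2; 2; 1] -> avoids (k :: w) [:: 2; 1; 1; 2] ->
  sorted (desc_from k) (k :: w).
Proof.
move=> n3 pw av av1 av2.
have mem x : (x \in k :: w) = (0 < x <= n).
  by rewrite (perm_mem pw) mem_double_word.
rewrite (sorted_pairwise (@desc_from_trans k)) pairwise_cons.
apply/andP; split; first by apply/allP => x _; apply: desc_from_min.
apply/(pairwiseP 0) => i j; rewrite !inE => iw jw ij.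
set x := nth 0 w i; set y := nth 0 w j.
have sxy : subseq [:: x; y] w.
  apply: (@subseq_of_indices w [:: i; j]); rewrite /= ?ij ?iw ?jw //.
have [->|kx] := eqVneq x k; first exact: desc_from_min.
have xw : x \in w by rewrite mem_nth.
have [yk|ky] := eqVneq y k; last first.
  have := @avoids_cyc_asc _ k x y av; rewrite /= eqxx => /(_ sxy).
  by move: kx ky; rewrite /cyc_asc /desc_from; lia.
(* Now [x] stands between the first letter and the copy of [k] at [j]; since
   [3 <= n], a third letter [z] is available to refute this. *)
have def_w : w = take j w ++ k :: drop j.+1 w.
  by rewrite -yk -drop_nth // cat_take_drop.
have xp : x \in take j w.
  by rewrite /x -(nth_take 0 ij) mem_nth // size_take jw.
have cx : count_mem x (k :: w) = 2.
  by rewrite (permP pw) count_double_word -mem inE xw orbT.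
have [z [zn un]] : exists z, 0 < z <= n /\ uniq [:: k; x; z].
  have [z zin /norP[zk zx]] : exists2 z, z \in [:: 1; 2; 3]
      & ~~ ((z == k) || (z == x)).
    apply/hasP; rewrite /=; move: kx; lia.
  exists z; split; first by move: zin; rewrite !inE; lia.
  by move: kx zk zx; rewrite /= !inE; lia.
move: av av1 av2 cx zn; rewrite -mem {mem pw} def_w => av av1 av2 cx zw.
by have := adjacent_heads av av1 av2 un cx zw; rewrite xp.
Qed.

Theorem theorem2p14 (n : nat) (hn : 3 <= n) :
  c n [:: [:: 1; 2; 3]; [:: 2; 3; 1]; [:: 3; 1; 2]] = n.
Proof.
pose W k := sort (desc_from k) (double_word n).
have sW k : sorted (desc_from k) (W k) by apply/sort_sorted/desc_from_total.
have headW k : k \in iota 1 n -> head 0 (W k) = k.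
  rewrite mem_iota add1n ltnS -mem_double_word.
  rewrite -(mem_sort (desc_from k)) -/(W k); have := sW k.
  case: (W k) => //= h s; rewrite (path_sortedE (@desc_from_trans k)).
  case/andP => /allP hs _; rewrite inE => /predU1P[//|/hs hk].
  by apply: (@desc_from_anti k); rewrite hk desc_from_min.
rewrite /c -[RHS](size_iota 1) -(size_map W); apply: perm_size.
apply: uniq_perm.
- by rewrite !filter_uniq // permutations_uniq.
- rewrite map_inj_in_uniq ?iota_uniq // => i j iin jin eqW.
  by rewrite -(headW i) // eqW headW.
move=> w; rewrite /nonnesting !mem_filter mem_permutations.
apply/idP/mapP => [/andP[av /andP[/andP[av1 av2] pw]]|[k kin ->]].
  case: w av av1 av2 pw => [|k w] av av1 av2 pw.
    by move: (perm_mem pw 1); rewrite in_nil mem_double_word; lia.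
  exists k.
    rewrite mem_iota add1n ltnS -mem_double_word -(perm_mem pw).
    exact: mem_head.
  apply: (sorted_eq (@desc_from_trans k) (@desc_from_anti k)) => //.
    exact: sorted_desc_from_head pw av av1 av2.
  by rewrite perm_sym perm_sort perm_sym.
by rewrite /= !(sorted_avoids (sW k)) //= perm_sort perm_refl.
Qed.
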